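(* Let $\mu_0$ be a complex parameter with $2\mu_0\notin\{-1,-2,-3,\ldots\}$ (in particular $\mu_0\neq-1/2$) and let $x\in\mathbb{R}$, $x\neq0$. Then the partial derivative of $\mathrm{M}_{\kappa,\mu}(x)$ with respect to $\mu$ (with $\kappa$ held fixed), evaluated at $\mu=\mu_0$, $\kappa=-\mu_0-\tfrac12$, is $$\left.\frac{\partial \mathrm{M}_{\kappa,\mu}(x)}{\partial\mu}\right|_{\mu=\mu_0,\,\kappa=-\mu_0-1/2}=x^{\mu_0+1/2}e^{x/2}\left[\ln x-\frac{x}{1+2\mu_0}\;{}_2F_2\!\left(\left.\begin{array}{c}1,1\\ 2(\mu_0+1),\,2\end{array}\right|-x\right)\right].$$
   Context: The Whittaker function is $\mathrm{M}_{\kappa,\mu}(x)=x^{\mu+1/2}e^{-x/2}\,{}_1F_1\!\left(\tfrac12+\mu-\kappa;\,1+2\mu;\,x\right)$, defined for $2\mu\neq-1,-2,\ldots$, where ${}_pF_q$ denotes the generalized hypergeometric function; for $x<0$ powers and logarithms are taken with the principal branch. *)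

(* Defs.v *)
(* Stdlib reals with Coquelicot's complex numbers. *)
From Stdlib Require Import Reals List Factorial Lra.
From Coquelicot Require Import Coquelicot.
Open Scope C_scope.

Definition Cexp (z : C) : C :=
  (exp (Re z) * cos (Im z), exp (Re z) * sin (Im z))%R.

(* Principal argument, in (-PI, PI]; it is PI on the negative real axis. *)
Definition Carg (z : C) : R :=
  if Rle_dec 0 (Im z) then acos (Re z / Cmod z) else (- acos (Re z / Cmod z))%R.

Definition Clog (z : C) : C := (ln (Cmod z), Carg z).

(* Principal power, meaningful for z <> 0. *)
Definition Cpower (z a : C) : C := Cexp (a * Clog z).

(* Sum of a complex series, meaningful when the series converges
   (see CSeries_unique). *)
Definition CSeries (a : nat -> C) : C :=
  (Series (fun n => Re (a n)), Series (fun n => Im (a n))).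

(* Pochhammer symbol a (a + 1) ... (a + n - 1). *)
Fixpoint poch (a : C) (n : nat) : C :=
  match n with
  | O => 1
  | S m => poch a m * (a + INR m)
  end.

Definition poch_prod (l : list C) (n : nat) : C :=
  fold_right (fun a p => poch a n * p) (RtoC 1) l.

(* The generalized hypergeometric function pFq, with p = length a and
   q = length b; meaningful when no element of b is a nonpositive integer and
   the series converges (in particular for all z when p <= q). *)
Definition hypergeom (a b : list C) (z : C) : C :=
  CSeries (fun n => poch_prod a n / poch_prod b n * (z ^ n / INR (fact n))).

(* Meaningful for x <> 0 and 2 * mu not a negative integer. *)
Definition WhittakerM (kappa mu x : C) : C :=
  Cpower x (mu + 1 / 2) * Cexp (- x / 2) *
  hypergeom (1 / 2 + mu - kappa :: nil) (1 + 2 * mu :: nil) x.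

Lemma CSeries_unique (a : nat -> C) (l : C) :
  is_series (K := C_AbsRing) (V := C_NormedModule) a l -> CSeries a = l.
Proof.
  intros H.
  assert (Hre : forall n, Re (sum_n (G := C_AbelianMonoid) a n) =
                          sum_n (fun k => Re (a k)) n).
  { intros n; induction n as [|n IH]; [now rewrite !sum_O|].
    rewrite !sum_Sn, <- IH; reflexivity. }
  assert (Him : forall n, Im (sum_n (G := C_AbelianMonoid) a n) =
                          sum_n (fun k => Im (a k)) n).
  { intros n; induction n as [|n IH]; [now rewrite !sum_O|].
    rewrite !sum_Sn, <- IH; reflexivity. }
  unfold CSeries; rewrite (surjective_pairing l); f_equal;
    apply is_series_unique; intros P [eps HP].
  - destruct (H (ball (M := C_UniformSpace) l eps)) as [N HN];
      [now exists eps|].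
    exists N; intros n Hn; rewrite <- Hre; apply HP, (HN n Hn).
  - destruct (H (ball (M := C_UniformSpace) l eps)) as [N HN];
      [now exists eps|].
    exists N; intros n Hn; rewrite <- Him; apply HP, (HN n Hn).
Qed.

Lemma Clog_pos (x : R) : (0 < x)%R -> Clog x = RtoC (ln x).
Proof.
  intros Hx; unfold Clog, Carg; rewrite Cmod_R, Rabs_pos_eq by lra; simpl.
  destruct (Rle_dec 0 0) as [_|H]; [|lra].
  replace (x / x)%R with 1%R by (field; lra).
  now rewrite acos_1.
Qed.

Lemma Clog_neg (x : R) : (x < 0)%R -> Clog x = (ln (- x), PI).
Proof.
  intros Hx; unfold Clog, Carg; rewrite Cmod_R, Rabs_left by lra; simpl.
  destruct (Rle_dec 0 0) as [_|H]; [|lra].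
  replace (x / - x)%R with (Ropp 1) by (field; lra).
  now rewrite acos_opp, acos_1, Rminus_0_r.
Qed.

(* Main.v *)
(* With c = 1 + 2 mu0 and h = mu - mu0, the 1F1 factor is
   sum_n (c + h)_n / (c + 2 h)_n x^n / n!, and
   (c + h)_n / (c + 2 h)_n = 1 - h S_n + O(2^n h^2), where S_n = sum_(k < n) 1 / (c + k);
   hence the 1F1 factor equals e^x at mu0 and has derivative - sum_n S_n x^n / n! there.
   Multiplying a series sum_n s_n x^n / n! by e^(-x) replaces s_n by its forward differences
   at 0; those of S_n are (-1)^(n-1) (n-1)! / (c)_n for n >= 1, which are the coefficients
   of x / c * 2F2(1, 1; c + 1, 2; -x). *)
Require Import Defs.
From Stdlib Require Import Reals List Factorial Lra Lia.
From Coquelicot Require Import Coquelicot.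
Open Scope C_scope.

(* [ring] and [field] need the equality at type [C] rather than at the carrier of a
   Coquelicot structure. *)
Ltac eq_at_C := match goal with |- ?a = ?b => change (a = b :> C) end.

(** * Complex differentiability from a quadratic remainder *)

(** The chain and product rules give derivatives over [AbsRing_NormedModule C_AbsRing], the theorem
    wants [C_NormedModule]. Both have the same operations and the norm [Cmod], so each component
    transfers. *)
Lemma is_derive_C_NormedModule (f : C -> C) (z l : C) :
  is_derive (K := C_AbsRing) (V := AbsRing_NormedModule C_AbsRing) f z l ->
  is_derive (K := C_AbsRing) (V := C_NormedModule) f z l.
Proof.
  intros [Hl H]. split.
  - destruct Hl as [H1 H2 H3]. split; assumption.
  - exact H.
Qed.

Lemma is_derive_quadratic (f : C -> C) (z l : C) (K d : R) :
  (0 < d)%R ->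
  (forall h, (Cmod h < d)%R ->
     (Cmod (f (z + h) - f z - h * l)%C <= K * Cmod h ^ 2)%R) ->
  is_derive (K := C_AbsRing) (V := AbsRing_NormedModule C_AbsRing) f z l.
Proof.
  intros Hd Hf. split; [apply is_linear_scal_l|].
  intros y Hy eps.
  apply (is_filter_lim_locally_unique (V := AbsRing_NormedModule C_AbsRing)) in Hy.
  subst y.
  (* For |h| below this radius, K |h|^2 <= eps |h|; adding 1 to |K| keeps the quotient defined when
     K = 0. *)
  assert (He : (0 < Rmin d (eps / (Rabs K + 1)))%R).
  { apply Rmin_pos; [assumption|]. apply Rdiv_lt_0_compat; [apply cond_pos|].
    pose proof (Rabs_pos K); lra. }
  exists (mkposreal _ He). intros w Hw. change C in w.
  change (Cmod (w - z)%C < Rmin d (eps / (Rabs K + 1)))%R in Hw.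
  change (Cmod (f w - f z - (w - z) * l)%C <= eps * Cmod (w - z)%C)%R.
  pose proof (Cmod_ge_0 (w - z)).
  pose proof (Rmin_l d (eps / (Rabs K + 1))).
  pose proof (Rmin_r d (eps / (Rabs K + 1))).
  specialize (Hf (w - z) ltac:(lra)).
  replace (z + (w - z))%C with (w : C) in Hf by (change (w = z + (w - z) :> C); ring).
  apply Rle_trans with (1 := Hf).
  replace (K * Cmod (w - z)%C ^ 2)%R with (K * Cmod (w - z)%C * Cmod (w - z)%C)%R by ring.
  apply Rmult_le_compat_r; [assumption|].
  pose proof (Rle_abs K). pose proof (Rabs_pos K).
  apply Rle_trans with ((Rabs K + 1) * Cmod (w - z)%C)%R; [nra|].
  replace (eps : R) with ((Rabs K + 1) * (eps / (Rabs K + 1)))%R by (field; lra).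
  apply Rmult_le_compat_l; lra.
Qed.

(** * The complex exponential and the principal power *)

Lemma Cmod_le_abs (z : C) : (Cmod z <= Rabs (Re z) + Rabs (Im z))%R.
Proof.
  destruct z as [a b]; simpl.
  replace ((a, b) : C) with (RtoC a + Ci * RtoC b)
    by (unfold RtoC, Ci, Cplus, Cmult; simpl; f_equal; ring).
  eapply Rle_trans; [apply Cmod_triangle|].
  rewrite Cmod_mult, Cmod_Ci, !Cmod_R. lra.
Qed.

Lemma Cexp_plus (a b : C) : Cexp (a + b) = Cexp a * Cexp b.
Proof.
  destruct a as [a1 a2], b as [b1 b2]; unfold Cexp, Cmult; simpl.
  rewrite exp_plus, cos_plus, sin_plus. f_equal; ring.
Qed.

Lemma Cexp_RtoC (x : R) : Cexp x = RtoC (exp x).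
Proof.
  unfold Cexp, RtoC; simpl. rewrite cos_0, sin_0. f_equal; ring.
Qed.

Lemma pow2_le_of_Rabs_le (a m : R) : (Rabs a <= m -> a ^ 2 <= m ^ 2)%R.
Proof.
  intros H. rewrite <- (pow2_abs a). apply pow_incr. split; [apply Rabs_pos|assumption].
Qed.

(** From 1 - a <= e^(-a) one gets e^a (1 - a) <= 1, hence e^a - 1 - a <= a^2 / (1 - a), and 1 - a >=
    1/2. *)
Lemma exp_minus_1_minus_x (a : R) :
  (Rabs a <= 1 / 2 -> 0 <= exp a - 1 - a <= 2 * a ^ 2)%R.
Proof.
  intros Ha. apply Rabs_le_between in Ha.
  pose proof (exp_ineq1_le a). pose proof (exp_ineq1_le (- a)) as H1.
  rewrite exp_Ropp in H1. pose proof (exp_pos a) as H2.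
  assert (exp a * (1 - a) <= 1)%R.
  { replace 1%R with (exp a * / exp a)%R at 2 by (field; lra).
    apply Rmult_le_compat_l; lra. }
  split; nra.
Qed.

(** Uses 1 - cos b = 2 sin^2 (b/2) and |sin t| <= |t|, the latter by the mean value theorem. *)
Lemma cos_minus_1 (b : R) : (0 <= 1 - cos b <= b ^ 2 / 2)%R.
Proof.
  split; [pose proof (COS_bound b); lra|].
  replace b with (2 * (b / 2))%R at 1 by field. rewrite cos_2a_sin.
  assert (Rabs (sin (b / 2)) <= Rabs (b / 2))%R.
  { destruct (MVT_gen sin 0 (b / 2) cos) as [t [_ Ht]].
    - intros t _. auto_derive; [easy|ring].
    - intros t _. reg.
    - rewrite sin_0, !Rminus_0_r in Ht. rewrite Ht, Rabs_mult.
      assert (Rabs (cos t) <= 1)%R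
        by (apply Rabs_le_between; pose proof (COS_bound t); lra).
      pose proof (Rabs_pos (b / 2)). nra. }
  apply Rsqr_le_abs_1 in H. unfold Rsqr in H. lra.
Qed.

(** The mean value theorem for sin t - t and [cos_minus_1] give |b|^3 / 2, which is at most b^2 when
    |b| <= 1. *)
Lemma sin_minus_x (b : R) : (Rabs b <= 1 -> Rabs (sin b - b) <= b ^ 2)%R.
Proof.
  intros Hb.
  destruct (MVT_gen (fun t => sin t - t)%R 0 b (fun t => cos t - 1)%R) as [t [Ht H]].
  - intros t _. auto_derive; [easy|ring].
  - intros t _. reg.
  - rewrite sin_0, !Rminus_0_r in H. rewrite H, Rabs_mult.
    assert (Rabs t <= Rabs b)%R.
    { unfold Rmin, Rmax in Ht. destruct (Rle_dec 0 b).
      - rewrite !Rabs_pos_eq; lra.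
      - rewrite !Rabs_left1; lra. }
    pose proof (cos_minus_1 t).
    assert (t ^ 2 <= Rabs b ^ 2)%R by now apply pow2_le_of_Rabs_le.
    rewrite <- (pow2_abs b).
    rewrite (Rabs_left1 (cos t - 1)) by lra.
    pose proof (Rabs_pos b). nra.
Qed.

Lemma Cexp_quadratic (h : C) :
  (Cmod h < 1 / 2 -> Cmod (Cexp h - 1 - h)%C <= 12 * Cmod h ^ 2)%R.
Proof.
  intros Hh. pose proof (Rmax_Cmod h) as Hm.
  pose proof (Rmax_l (Rabs (fst h)) (Rabs (snd h))).
  pose proof (Rmax_r (Rabs (fst h)) (Rabs (snd h))).
  destruct h as [a b]; cbn [fst snd] in *.
  set (m := Cmod (a, b)) in *.
  assert (Ha : (Rabs a <= m)%R) by lra. assert (Hb : (Rabs b <= m)%R) by lra.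
  eapply Rle_trans; [apply Cmod_le_abs|].
  pose proof (exp_minus_1_minus_x a ltac:(lra)) as He.
  pose proof (cos_minus_1 b) as Hc.
  pose proof (sin_minus_x b ltac:(lra)) as Hs.
  assert (Ha2 : (a ^ 2 <= m ^ 2)%R) by now apply pow2_le_of_Rabs_le.
  assert (Hb2 : (b ^ 2 <= m ^ 2)%R) by now apply pow2_le_of_Rabs_le.
  assert (He2 : (exp a <= 2)%R) by (apply Rabs_le_between in Ha; nra).
  pose proof (exp_pos a).
  assert (Hab : (Rabs (b * (exp a - 1)) <= 2 * m ^ 2)%R).
  { rewrite Rabs_mult.
    assert (Rabs (exp a - 1) <= 2 * m)%R.
    { apply Rabs_le_between in Ha. apply Rabs_le_between. nra. }
    pose proof (Rabs_pos b). pose proof (Rabs_pos (exp a - 1)). nra. }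
  (* Both components are regrouped into products of the real remainders, at most 3 m^2 and 4 m^2;
     the constant 12 is generous. *)
  replace (Re (Cexp (a, b) - 1 - (a, b)))
    with (exp a - 1 - a - exp a * (1 - cos b))%R
    by (unfold Cexp; simpl; ring).
  replace (Im (Cexp (a, b) - 1 - (a, b)))
    with (exp a * (sin b - b) + b * (exp a - 1))%R
    by (unfold Cexp; simpl; ring).
  assert (Rabs (exp a - 1 - a - exp a * (1 - cos b)) <= 3 * m ^ 2)%R
    by (apply Rabs_le_between; nra).
  assert (Rabs (exp a * (sin b - b) + b * (exp a - 1)) <= 4 * m ^ 2)%R.
  { eapply Rle_trans; [apply Rabs_triang|]. rewrite (Rabs_mult (exp a)).
    rewrite (Rabs_pos_eq (exp a)) by lra.
    pose proof (Rabs_pos (sin b - b)). nra. }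
  nra.
Qed.

(** The functional equation reduces the increment at z to the one at 0, scaled by [Cexp z]. *)
Lemma is_derive_Cexp (z : C) :
  is_derive (K := C_AbsRing) (V := AbsRing_NormedModule C_AbsRing) Cexp z (Cexp z).
Proof.
  apply is_derive_quadratic with (K := (12 * Cmod (Cexp z))%R) (d := (1 / 2)%R); [lra|].
  intros h Hh.
  replace (Cexp (z + h) - Cexp z - h * Cexp z) with (Cexp z * (Cexp h - 1 - h))
    by (rewrite Cexp_plus; ring).
  rewrite Cmod_mult. pose proof (Cexp_quadratic h Hh). pose proof (Cmod_ge_0 (Cexp z)). nra.
Qed.

Lemma is_derive_Cpower (z a w : C) :
  is_derive (K := C_AbsRing) (V := AbsRing_NormedModule C_AbsRing)
    (fun mu : C => Cpower z (mu + a)) w (Clog z * Cpower z (w + a)).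
Proof.
  unfold Cpower.
  apply (is_derive_comp (K := C_AbsRing) (V := AbsRing_NormedModule C_AbsRing)
           Cexp (fun mu : C => (mu + a) * Clog z)).
  - apply is_derive_Cexp.
  (* The exponent is affine in mu, so its remainder is identically 0. *)
  - apply is_derive_quadratic with (K := 0%R) (d := 1%R); [lra|].
    intros h _.
    replace ((w + h + a) * Clog z - (w + a) * Clog z - h * Clog z) with (RtoC 0) by ring.
    rewrite Cmod_0. lra.
Qed.

Notation Cis_series := (is_series (K := C_AbsRing) (V := C_NormedModule)).

(** Completeness gives the limit, and the bound on partial sums survives passage to it. The bound is
    kept because the O(h^2) remainder must be summed over n. *)
Lemma Cis_series_dominated (a : nat -> C) (b : nat -> R) (B : R) :
  (forall n, (Cmod (a n) <= b n)%R) -> is_series b B ->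
  exists l : C, Cis_series a l /\ (Cmod l <= B)%R.
Proof.
  intros Hab Hb.
  destruct (ex_series_le (K := C_AbsRing) (V := C_CompleteNormedModule) a b) as [l Hl].
  - exact Hab.
  - now exists B.
  - exists l. split; [exact Hl|].
    assert (Hn := filterlim_comp _ _ _ _ _ _ _ _ Hl
                    (filterlim_norm (K := C_AbsRing) (V := C_NormedModule) l)).
    change (Rbar_le (Cmod l) B).
    apply (is_lim_seq_le (fun n => Cmod (sum_n (G := C_AbelianMonoid) a n)) (sum_n b));
      [|exact Hn|exact Hb].
    intros n.
    eapply Rle_trans; [apply (norm_sum_n_m (K := C_AbsRing) (V := C_NormedModule))|].
    apply sum_n_m_le. exact Hab.
Qed.

(** * Newton's forward difference formula *)

Lemma INR_S_C (n : nat) : RtoC (INR (S n)) = RtoC (INR n) + 1.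
Proof. now rewrite S_INR, RtoC_plus. Qed.

Lemma sum_n_Cmult_l (k : C) (a : nat -> C) (n : nat) :
  sum_n (G := C_AbelianMonoid) (fun i => k * a i) n =
  k * sum_n (G := C_AbelianMonoid) a n.
Proof. exact (sum_n_mult_l (K := C_Ring) k a n). Qed.

(* Multiplying by N + 1 = n + (N + 1 - n) splits the sum for N + 1 into those for N
   of g (S n) k and of g n k. *)
Lemma newton_forward (g : nat -> nat -> C) :
  (forall n k, g (S n) k = g n (S k) - g n k) ->
  forall N k,
  sum_n (G := C_AbelianMonoid)
    (fun n => g n k * (/ INR (fact n) * / INR (fact (N - n)))%R) N =
  g O (N + k)%nat * (/ INR (fact N))%R.
Proof.
  intros Hg. induction N as [|N IH]; intros k.
  - rewrite sum_O. simpl. f_equal. f_equal. field.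
  - assert (HN : (INR (S N) <> 0)%R) by (apply not_0_INR; lia).
    assert (HNC : RtoC (INR (S N)) <> 0) by (intros H; apply HN; now injection H).
    set (p := fun n => g n k * (INR n / INR (fact n) / INR (fact (S N - n)))%R).
    set (q := fun n => g n k * (INR (S N - n) / INR (fact n) / INR (fact (S N - n)))%R).
    assert (Hsum : sum_n (G := C_AbelianMonoid) (fun n => INR (S N) *
       (g n k * (/ INR (fact n) * / INR (fact (S N - n)))%R)) (S N) =
       sum_n (G := C_AbelianMonoid) (fun n => plus (p n) (q n)) (S N)).
    { apply sum_n_ext_loc. intros n Hn. unfold p, q.
      change plus with Cplus. rewrite minus_INR by assumption.
      pose proof (INR_fact_neq_0 n). pose proof (INR_fact_neq_0 (S N - n)).
      rewrite <- Cmult_plus_distr_l, Cmult_assoc, (Cmult_comm (INR (S N))), <- Cmult_assoc.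
      rewrite <- RtoC_mult, <- RtoC_plus. f_equal. f_equal. field. easy. }
    rewrite sum_n_Cmult_l, sum_n_plus in Hsum.
    assert (Hp : sum_n (G := C_AbelianMonoid) p (S N) = sum_n (G := C_AbelianMonoid)
       (fun n => g (S n) k * (/ INR (fact n) * / INR (fact (N - n)))%R) N).
    { unfold sum_n at 1. rewrite sum_Sn_m by lia. rewrite <- sum_n_m_S.
      replace (p O) with (zero : C_AbelianMonoid).
      2:{ unfold p. simpl INR. change zero with (RtoC 0).
          unfold Rdiv. rewrite !Rmult_0_l. symmetry. apply Cmult_0_r. }
      rewrite plus_zero_l. apply sum_n_ext_loc. intros n Hn. unfold p.
      replace (S N - S n)%nat with (N - n)%nat by lia. f_equal. f_equal.
      rewrite fact_simpl, mult_INR.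
      pose proof (INR_fact_neq_0 n). pose proof (INR_fact_neq_0 (N - n)).
      assert (INR (S n) <> 0)%R by (apply not_0_INR; lia). field. easy. }
    assert (Hq : sum_n (G := C_AbelianMonoid) q (S N) = sum_n (G := C_AbelianMonoid)
       (fun n => g n k * (/ INR (fact n) * / INR (fact (N - n)))%R) N).
    { rewrite sum_Sn. replace (q (S N)) with (zero : C_AbelianMonoid).
      2:{ unfold q. rewrite Nat.sub_diag. simpl INR. change zero with (RtoC 0).
          unfold Rdiv. rewrite !Rmult_0_l. symmetry. apply Cmult_0_r. }
      rewrite plus_zero_r. apply sum_n_ext_loc. intros n Hn. unfold q.
      replace (S N - n)%nat with (S (N - n))%nat by lia. f_equal. f_equal.
      rewrite fact_simpl, mult_INR.
      pose proof (INR_fact_neq_0 n). pose proof (INR_fact_neq_0 (N - n)).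
      assert (INR (S (N - n)) <> 0)%R by (apply not_0_INR; lia). field. easy. }
    rewrite Hp, Hq, <- sum_n_plus in Hsum.
    (* The difference relation merges both sums into the one for N at [S k]; hence the induction is
       over N for all k at once. *)
    erewrite (sum_n_ext (fun n => plus _ _)) in Hsum.
    2:{ intros n. rewrite Hg. change plus with Cplus.
        rewrite <- Cmult_plus_distr_r.
        replace (g n (S k) - g n k + g n k) with (g n (S k)) by ring. reflexivity. }
    rewrite IH in Hsum.
    replace (S N + k)%nat with (N + S k)%nat by lia.
    match goal with |- ?s = _ =>
      replace s with (/ INR (S N) * (INR (S N) * s)) by (field; exact HNC) end.
    rewrite Hsum. rewrite fact_simpl, mult_INR, Rinv_mult, RtoC_mult, (RtoC_inv (INR (S N)) HN).
    eq_at_C. ring.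
Qed.

(** * Forward differences of 1 / (c + k) and of its partial sums *)

Lemma poch_S_l (c : C) (n : nat) : poch c (S n) = c * poch (c + 1) n.
Proof.
  induction n as [|n IH].
  - simpl. ring.
  - change (poch c (S (S n))) with (poch c (S n) * (c + INR (S n))).
    rewrite IH. simpl poch. rewrite INR_S_C. ring.
Qed.

Lemma poch_neq_0 (c : C) (n : nat) : (forall k, c + INR k <> 0) -> poch c n <> 0.
Proof.
  intros Hc. induction n as [|n IH]; simpl.
  - intros H; injection H; lra.
  - now apply Cmult_neq_0.
Qed.

(* (-1)^n n! / (c + k)_(n+1) is the n-th forward difference of k |-> 1 / (c + k). *)
Definition inv_diff (c : C) (n k : nat) : C :=
  (- (1)) ^ n * INR (fact n) / poch (c + INR k) (S n).

(** With u = c + k, the two reciprocals have common denominator u (u+1)_n (u+n+1) = (u)_(n+2) and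
    numerator u - (u+n+1) = -(n+1). *)
Lemma inv_diff_S (c : C) (n k : nat) : (forall j, c + INR j <> 0) ->
  inv_diff c (S n) k = inv_diff c n (S k) - inv_diff c n k.
Proof.
  intros Hc. unfold inv_diff.
  assert (Hk : forall j, c + INR k + INR j <> 0)
    by (intros j; rewrite <- Cplus_assoc, <- RtoC_plus, <- plus_INR; apply Hc).
  replace (c + INR (S k)) with (c + INR k + 1) by (rewrite INR_S_C; ring).
  rewrite (poch_S_l (c + INR k) (S n)), (poch_S_l (c + INR k) n).
  assert (Hk1 : forall j, c + INR k + 1 + INR j <> 0).
  { intros j. replace (c + INR k + 1 + INR j) with (c + INR k + INR (S j))
      by (rewrite INR_S_C; ring). apply Hk. }
  assert (Hp := poch_neq_0 _ n Hk1). specialize (Hk1 n). specialize (Hk O).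
  rewrite Cplus_0_r in Hk.
  simpl poch. rewrite fact_simpl, mult_INR, RtoC_mult, INR_S_C.
  set (P := poch _ _) in *. set (u := c + INR k) in *.
  simpl Cpow. field. auto.
Qed.

Fixpoint shifted_harmonic (c : C) (n : nat) : C :=
  match n with
  | O => 0
  | S m => shifted_harmonic c m + / (c + INR m)
  end.

(* The [n]-th forward difference of [shifted_harmonic c] at 0. *)
Definition harmonic_diff (c : C) (n : nat) : C :=
  match n with
  | O => 0
  | S m => inv_diff c m 0
  end.

(** This is [newton_forward] at k = 0 for the difference table with row 0 [shifted_harmonic c] and
    row m + 1 [inv_diff c m]. It compares coefficients in e^x times the series of
    [harmonic_diff c]. *)
Lemma shifted_harmonic_convolution (c : C) (N : nat) : (forall j, c + INR j <> 0) ->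
  sum_n (G := C_AbelianMonoid)
    (fun n => harmonic_diff c n * (/ INR (fact n) * / INR (fact (N - n)))%R) N =
  shifted_harmonic c N * (/ INR (fact N))%R.
Proof.
  intros Hc.
  pose (g := fun n k => match n with O => shifted_harmonic c k | S m => inv_diff c m k end).
  assert (Hg : forall n k, g (S n) k = g n (S k) - g n k).
  { intros [|n] k; simpl.
    - unfold inv_diff. simpl. specialize (Hc k). field. assumption.
    - now apply inv_diff_S. }
  assert (H := newton_forward g Hg N 0). rewrite Nat.add_0_r in H.
  etransitivity; [|exact H].
  apply sum_n_ext. intros [|n]; reflexivity.
Qed.

(** * The exponential series and Cauchy products *)

Lemma is_series_exp (y : R) : is_series (fun n => y ^ n / INR (fact n))%R (exp y).
Proof.
  apply is_series_ext with (2 := is_exp_Reals y).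
  intros n. rewrite pow_n_pow. reflexivity.
Qed.

Lemma Re_sum_n (a : nat -> C) (n : nat) :
  Re (sum_n (G := C_AbelianMonoid) a n) = sum_n (fun k => Re (a k)) n.
Proof.
  induction n as [|n IH]; [now rewrite !sum_O|].
  rewrite !sum_Sn, <- IH; reflexivity.
Qed.

Lemma Im_sum_n (a : nat -> C) (n : nat) :
  Im (sum_n (G := C_AbelianMonoid) a n) = sum_n (fun k => Im (a k)) n.
Proof.
  induction n as [|n IH]; [now rewrite !sum_O|].
  rewrite !sum_Sn, <- IH; reflexivity.
Qed.

Lemma CSeries_ext (a b : nat -> C) : (forall n, a n = b n) -> CSeries a = CSeries b.
Proof.
  intros H. unfold CSeries. f_equal; apply Series_ext; intros n; now rewrite H.
Qed.

Lemma Series_mult (a b : nat -> R) :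
  ex_series (fun n => Rabs (a n)) -> ex_series (fun n => Rabs (b n)) ->
  Series (fun n => sum_n (fun k => a k * b (n - k)%nat)%R n) = (Series a * Series b)%R.
Proof.
  intros Ha Hb. apply is_series_unique.
  eapply is_series_ext; [intros n; symmetry; apply sum_n_Reals|].
  apply is_series_mult; auto using Series_correct, ex_series_Rabs.
Qed.

(** As the second factor is real, multiplication acts separately on real and imaginary parts, and
    the real Cauchy product applies to each. *)
Lemma CSeries_mult_RtoC (a : nat -> C) (b : nat -> R) :
  ex_series (fun n => Cmod (a n)) -> ex_series (fun n => Rabs (b n)) ->
  CSeries (fun n => sum_n (G := C_AbelianMonoid) (fun k => a k * b (n - k)%nat) n) =
  CSeries a * Series b.
Proof.
  intros Ha Hb.
  assert (HRe : ex_series (fun n => Rabs (Re (a n)))).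
  { apply (ex_series_le (K := R_AbsRing) (V := R_CompleteNormedModule)) with (2 := Ha).
    intros n. change (Rabs (Rabs (Re (a n))) <= Cmod (a n))%R.
    rewrite Rabs_Rabsolu. apply re_le_Cmod. }
  assert (HIm : ex_series (fun n => Rabs (Im (a n)))).
  { apply (ex_series_le (K := R_AbsRing) (V := R_CompleteNormedModule)) with (2 := Ha).
    intros n. change (Rabs (Rabs (Im (a n))) <= Cmod (a n))%R.
    rewrite Rabs_Rabsolu.
    eapply Rle_trans; [apply Rmax_r|apply Rmax_Cmod]. }
  assert (Hr : forall (z : C) (r : R), z * r = (Re z * r, Im z * r)%R).
  { intros [u v] r. unfold Cmult, RtoC. simpl. f_equal; ring. }
  rewrite (Hr (CSeries a)). unfold CSeries. cbn [Re Im fst snd].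
  rewrite <- !Series_mult by assumption.
  f_equal; apply Series_ext; intros n; rewrite ?Re_sum_n, ?Im_sum_n;
    apply sum_n_ext; intros k; now rewrite Hr.
Qed.

(** * Estimates for the ratio (c + h)_n / (c + 2 h)_n *)

(** Once j >= 2 |c| + 1, |c + j| >= j - |c| >= (j + 1) / 2; the finitely many smaller j are handled
    by a minimum. The growth in j is what later bounds 1 / (c)_n by a power over n!. *)
Lemma Cmod_shift_lower_bound (c : C) : (forall j, c + INR j <> 0) ->
  exists d, (0 < d)%R /\ forall j, (d * INR (S j) <= Cmod (c + INR j))%R.
Proof.
  intros Hc.
  assert (H : forall N, exists d, (0 < d)%R /\
            forall j, (j < N)%nat -> (d * INR (S j) <= Cmod (c + INR j))%R).
  { induction N as [|N [d [Hd IH]]].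
    - exists 1%R. split; [lra|]. lia.
    - assert (HN : (0 < Cmod (c + INR N))%R) by now apply Cmod_gt_0.
      assert (HS : forall j, (0 < INR (S j))%R) by (intros j; apply lt_0_INR; lia).
      exists (Rmin d (Cmod (c + INR N) / INR (S N))). split.
      + apply Rmin_pos; [assumption|]. now apply Rdiv_lt_0_compat.
      + intros j Hj. pose proof (HS j) as Hj0.
        destruct (Nat.eq_dec j N) as [->|Hne].
        * apply Rle_trans with (Cmod (c + INR N) / INR (S N) * INR (S N))%R.
          -- apply Rmult_le_compat_r; [lra|apply Rmin_r].
          -- right. field. lra.
        * eapply Rle_trans; [|apply (IH j); lia].
          apply Rmult_le_compat_r; [lra|apply Rmin_l]. }
  destruct (INR_unbounded (2 * Cmod c + 1)) as [N HN].
  destruct (H N) as [d [Hd Hlt]].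
  exists (Rmin d (1 / 2)). split; [apply Rmin_pos; lra|].
  intros j. assert (Hj0 : (0 < INR (S j))%R) by (apply lt_0_INR; lia).
  destruct (Nat.lt_ge_cases j N) as [Hj|Hj].
  - eapply Rle_trans; [|apply Hlt, Hj]. apply Rmult_le_compat_r; [lra|apply Rmin_l].
  - apply Rle_trans with (1 / 2 * INR (S j))%R.
    { apply Rmult_le_compat_r; [lra|apply Rmin_r]. }
    apply le_INR in Hj. rewrite S_INR.
    assert (Ht := Cmod_triangle (c + INR j) (- c)).
    replace (c + INR j + - c) with (RtoC (INR j)) in Ht by ring.
    rewrite Cmod_R, Cmod_opp, Rabs_pos_eq in Ht by apply pos_INR. lra.
Qed.

Lemma Cmod_inv_le (z : C) (d : R) : (0 < d <= Cmod z)%R -> (Cmod (/ z) <= / d)%R.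
Proof.
  intros Hd. rewrite Cmod_inv.
  - apply Rinv_le_contravar; lra.
  - apply Cmod_gt_0. lra.
Qed.

Definition poch_ratio (c h : C) (n : nat) : C := poch (c + h) n / poch (c + 2 * h) n.

(** The radius d / 4 makes |2 h| <= d / 2, so at least half of the lower bound remains. *)
Lemma Cmod_double_shift (c h : C) (d : R) (j : nat) :
  (0 < d)%R -> (forall j, (d <= Cmod (c + INR j))%R) -> (Cmod h <= d / 4)%R ->
  (d / 2 <= Cmod (c + 2 * h + INR j))%R.
Proof.
  intros Hd Hc Hh.
  assert (Ht := Cmod_triangle (c + 2 * h + INR j) (- (2 * h))).
  replace (c + 2 * h + INR j + - (2 * h)) with (c + INR j) in Ht by ring.
  rewrite Cmod_opp, Cmod_mult, Cmod_R, Rabs_pos_eq in Ht by lra.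
  specialize (Hc j). lra.
Qed.

Lemma double_shift_neq_0 (c h : C) (d : R) (j : nat) :
  (0 < d)%R -> (forall j, (d <= Cmod (c + INR j))%R) -> (Cmod h <= d / 4)%R ->
  c + 2 * h + INR j <> 0.
Proof.
  intros Hd Hc Hh.
  apply Cmod_gt_0. pose proof (Cmod_double_shift c h d j Hd Hc Hh). lra.
Qed.

(** The new factor is (c + h + n) / (c + 2 h + n); all later estimates are inductions on this
    recurrence. *)
Lemma poch_ratio_S (c h : C) (d : R) (n : nat) :
  (0 < d)%R -> (forall j, (d <= Cmod (c + INR j))%R) -> (Cmod h <= d / 4)%R ->
  poch_ratio c h (S n) = poch_ratio c h n * (1 - h / (c + 2 * h + INR n)).
Proof.
  intros Hd Hc Hh.
  unfold poch_ratio. simpl.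
  pose proof (double_shift_neq_0 c h d n Hd Hc Hh).
  pose proof (poch_neq_0 _ n (fun j => double_shift_neq_0 c h d j Hd Hc Hh)).
  field. auto.
Qed.

Lemma Cmod_poch_ratio_factor (c h : C) (d : R) (n : nat) :
  (0 < d)%R -> (forall j, (d <= Cmod (c + INR j))%R) -> (Cmod h <= d / 4)%R ->
  (Cmod (h / (c + 2 * h + INR n)) <= 2 / d * Cmod h)%R.
Proof.
  intros Hd Hc Hh.
  unfold Cdiv. rewrite Cmod_mult.
  assert (Hi := Cmod_inv_le (c + 2 * h + INR n) (d / 2)
                  ltac:(pose proof (Cmod_double_shift c h d n Hd Hc Hh); lra)).
  replace (/ (d / 2))%R with (2 / d)%R in Hi by (field; lra).
  pose proof (Cmod_ge_0 h). nra.
Qed.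

(** Each factor has modulus at most 1 + (2 / d) |h| <= 2. *)
Lemma Cmod_poch_ratio (c h : C) (d : R) (n : nat) :
  (0 < d)%R -> (forall j, (d <= Cmod (c + INR j))%R) -> (Cmod h <= d / 4)%R ->
  (Cmod (poch_ratio c h n) <= 2 ^ n)%R.
Proof.
  intros Hd Hc Hh.
  induction n as [|n IH].
  - unfold poch_ratio. simpl. replace (1 / 1) with (RtoC 1) by field. rewrite Cmod_1. lra.
  - rewrite (poch_ratio_S c h d n Hd Hc Hh), Cmod_mult. simpl pow. rewrite Rmult_comm.
    apply Rmult_le_compat; auto using Cmod_ge_0.
    assert (Ht := Cmod_triangle 1 (- (h / (c + 2 * h + INR n)))).
    rewrite Cmod_1, Cmod_opp in Ht.
    pose proof (Cmod_poch_ratio_factor c h d n Hd Hc Hh) as Hf.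
    assert (2 / d * Cmod h <= 1)%R.
    { apply Rle_trans with (2 / d * (d / 4))%R.
      - apply Rmult_le_compat_l; [apply Rdiv_le_0_compat|]; lra.
      - replace (2 / d * (d / 4))%R with (1 / 2)%R by (field; lra). lra. }
    unfold Cminus. lra.
Qed.

(** Writing r for the ratio and q for the subtracted fraction, r (1 - q) - 1 = (r - 1) - r q; both
    terms are at most 2^n (2 / d) |h|, so the bound doubles. *)
Lemma Cmod_poch_ratio_minus_1 (c h : C) (d : R) (n : nat) :
  (0 < d)%R -> (forall j, (d <= Cmod (c + INR j))%R) -> (Cmod h <= d / 4)%R ->
  (Cmod (poch_ratio c h n - 1) <= 2 ^ n * (2 / d * Cmod h))%R.
Proof.
  intros Hd Hc Hh.
  induction n as [|n IH].
  - unfold poch_ratio. simpl. replace (1 / 1 - 1) with (RtoC 0) by field. rewrite Cmod_0.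
    pose proof (Cmod_ge_0 h). assert (0 < 2 / d)%R by (apply Rdiv_lt_0_compat; lra). nra.
  - rewrite (poch_ratio_S c h d n Hd Hc Hh).
    set (q := h / (c + 2 * h + INR n)).
    replace (poch_ratio c h n * (1 - q) - 1) with ((poch_ratio c h n - 1) + - (poch_ratio c h n * q)) by ring.
    eapply Rle_trans; [apply Cmod_triangle|].
    rewrite Cmod_opp, Cmod_mult.
    assert (Cmod (poch_ratio c h n) * Cmod q <= 2 ^ n * (2 / d * Cmod h))%R.
    { apply Rmult_le_compat; eauto using Cmod_ge_0, Cmod_poch_ratio, Cmod_poch_ratio_factor. }
    simpl pow. lra.
Qed.

(* Since 1 - h / (c + 2 h + n) = 1 - h / (c + n) + E with |E| <= 4 |h|^2 / d^2. *)
Lemma poch_ratio_quadratic (c h : C) (d : R) (n : nat) :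
  (0 < d)%R -> (forall j, (d <= Cmod (c + INR j))%R) -> (Cmod h <= d / 4)%R ->
  (Cmod (poch_ratio c h n - 1 + h * shifted_harmonic c n) <= 2 ^ n * (6 / d ^ 2 * Cmod h ^ 2))%R.
Proof.
  intros Hd Hc Hh.
  assert (Hd2 : (0 < / d)%R) by now apply Rinv_0_lt_compat.
  pose proof (Cmod_ge_0 h) as Hh0.
  assert (HK : (0 <= 6 / d ^ 2 * Cmod h ^ 2)%R).
  { apply Rmult_le_pos; [apply Rdiv_le_0_compat; [lra|apply pow_lt, Hd]|apply pow_le, Hh0]. }
  induction n as [|n IH].
  - unfold poch_ratio. simpl. replace (1 / 1 - 1 + h * 0) with (RtoC 0) by field.
    rewrite Cmod_0. simpl in HK. lra.
  - rewrite (poch_ratio_S c h d n Hd Hc Hh). simpl shifted_harmonic.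
    assert (Hcn : c + INR n <> 0) by (apply Cmod_gt_0; specialize (Hc n); lra).
    pose proof (double_shift_neq_0 c h d n Hd Hc Hh) as Hpn.
    replace (poch_ratio c h n * (1 - h / (c + 2 * h + INR n)) - 1 +
             h * (shifted_harmonic c n + / (c + INR n)))
      with ((poch_ratio c h n - 1 + h * shifted_harmonic c n) +
            (- (h * / (c + INR n) * (poch_ratio c h n - 1)) +
             poch_ratio c h n * (2 * (h * / (c + INR n) * (h / (c + 2 * h + INR n))))))
      by (field; auto).
    eapply Rle_trans; [apply Cmod_triangle|].
    eapply Rle_trans; [apply Rplus_le_compat_l, Cmod_triangle|].
    rewrite Cmod_opp, !(Cmod_mult _ (poch_ratio c h n - 1)), (Cmod_mult (poch_ratio c h n)), !(Cmod_mult 2),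
      Cmod_R, Rabs_pos_eq, (Cmod_mult (h * / (c + INR n))), (Cmod_mult h) by lra.
    pose proof (Cmod_poch_ratio_minus_1 c h d n Hd Hc Hh) as H1.
    pose proof (Cmod_poch_ratio c h d n Hd Hc Hh) as H2.
    pose proof (Cmod_poch_ratio_factor c h d n Hd Hc Hh) as H3.
    assert (Hi := Cmod_inv_le (c + INR n) d ltac:(specialize (Hc n); lra)).
    assert (H4 : (Cmod h * Cmod (/ (c + INR n)) <= / d * Cmod h)%R) by nra.
    pose proof (Cmod_ge_0 (/ (c + INR n))).
    assert (H5 : (0 <= Cmod h * Cmod (/ (c + INR n)))%R) by now apply Rmult_le_pos.
    set (y := (Cmod h * Cmod (/ (c + INR n)))%R) in *.
    assert (H6 : (y * Cmod (poch_ratio c h n - 1) <= / d * Cmod h * (2 ^ n * (2 / d * Cmod h)))%R).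
    { apply Rmult_le_compat; auto using Cmod_ge_0. }
    assert (H7 : (Cmod (poch_ratio c h n) * (2 * (y * Cmod (h / (c + 2 * h + INR n))))
                  <= 2 ^ n * (2 * (/ d * Cmod h * (2 / d * Cmod h))))%R).
    { apply Rmult_le_compat; auto using Cmod_ge_0.
      - apply Rmult_le_pos; [lra|]. apply Rmult_le_pos; auto using Cmod_ge_0.
      - apply Rmult_le_compat_l; [lra|].
        apply Rmult_le_compat; auto using Cmod_ge_0. }
    (* The cross term and the E term contribute 2 / d^2 and 4 / d^2 times 2^n |h|^2, which is where
       6 comes from: together they double the bound. *)
    replace (2 ^ S n * (6 / d ^ 2 * Cmod h ^ 2))%R
      with (2 ^ n * (6 / d ^ 2 * Cmod h ^ 2) +
            (/ d * Cmod h * (2 ^ n * (2 / d * Cmod h)) +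
             2 ^ n * (2 * (/ d * Cmod h * (2 / d * Cmod h)))))%R
      by (simpl; field; lra).
    lra.
Qed.

(** * Termwise differentiation of the 1F1 factor *)

Lemma INR_fact_neq_0_C (n : nat) : RtoC (INR (fact n)) <> 0.
Proof. intros H. apply (INR_fact_neq_0 n). now injection H. Qed.

Lemma Cmod_exp_term (z : C) (n : nat) :
  Cmod (z ^ n / INR (fact n)) = (Cmod z ^ n / INR (fact n))%R.
Proof.
  rewrite Cmod_div, Cmod_pow, Cmod_R, Rabs_pos_eq; [easy|apply pos_INR|].
  apply INR_fact_neq_0_C.
Qed.

(** Comparison with M (y |z|)^n / n!. Geometric bounds on coefficients, however crude, therefore
    suffice throughout. *)
Lemma Cis_series_exp_dominated (a : nat -> C) (z : C) (M y : R) :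
  (0 <= M)%R -> (0 <= y)%R -> (forall n, (Cmod (a n) <= M * y ^ n)%R) ->
  exists l : C, Cis_series (fun n => a n * (z ^ n / INR (fact n))) l /\
                (Cmod l <= M * exp (y * Cmod z))%R.
Proof.
  intros HM Hy Ha.
  apply Cis_series_dominated
    with (b := fun n => (M * ((y * Cmod z) ^ n / INR (fact n)))%R).
  - intros n. rewrite Cmod_mult, Cmod_exp_term, Rpow_mult_distr.
    replace (M * (y ^ n * Cmod z ^ n / INR (fact n)))%R
      with (M * y ^ n * (Cmod z ^ n / INR (fact n)))%R by (unfold Rdiv; ring).
    apply Rmult_le_compat_r; [|apply Ha].
    rewrite <- Cmod_exp_term. apply Cmod_ge_0.
  - apply (is_series_scal (K := R_AbsRing) (V := R_NormedModule) M), is_series_exp.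
Qed.

Lemma Cmod_shifted_harmonic (c : C) (d : R) (n : nat) :
  (0 < d)%R -> (forall j, (d <= Cmod (c + INR j))%R) ->
  (Cmod (shifted_harmonic c n) <= / d * 2 ^ n)%R.
Proof.
  intros Hd Hc. assert (Hi : (0 < / d)%R) by now apply Rinv_0_lt_compat.
  induction n as [|n IH]; simpl.
  - rewrite Cmod_0. lra.
  - eapply Rle_trans; [apply Cmod_triangle|].
    assert (Hn := Cmod_inv_le (c + INR n) d ltac:(specialize (Hc n); lra)).
    assert (1 <= 2 ^ n)%R by (apply pow_R1_Rle; lra). nra.
Qed.

Lemma hypergeom_1F1_diag (c z : C) : (forall j, c + INR j <> 0) ->
  hypergeom (c :: nil) (c :: nil) z = CSeries (fun n => z ^ n / INR (fact n)).
Proof.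
  intros Hc. apply CSeries_ext. intros n. simpl.
  pose proof (poch_neq_0 c n Hc). pose proof (INR_fact_neq_0_C n). field. auto.
Qed.

(** Summing [poch_ratio_quadratic] against z^n / n! gives K = 6 e^(2 |z|) / d^2, uniformly for |h| <
    d / 4. *)
Lemma hypergeom_1F1_diag_quadratic (c z : C) : (forall j, c + INR j <> 0) ->
  exists K d, (0 < d)%R /\ forall h, (Cmod h < d)%R ->
  (Cmod (hypergeom (c + h :: nil) (c + 2 * h :: nil) z - hypergeom (c :: nil) (c :: nil) z
         - h * - CSeries (fun n => shifted_harmonic c n * (z ^ n / INR (fact n))))%C
   <= K * Cmod h ^ 2)%R.
Proof.
  intros Hc0. destruct (Cmod_shift_lower_bound c Hc0) as [d [Hd Hdj]].
  assert (Hc : forall j, (d <= Cmod (c + INR j))%R).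
  { intros j. eapply Rle_trans; [|apply Hdj]. rewrite S_INR. pose proof (pos_INR j). nra. }
  exists (6 / d ^ 2 * exp (2 * Cmod z))%R, (d / 4)%R. split; [lra|].
  intros h Hh. apply Rlt_le in Hh.
  rewrite (hypergeom_1F1_diag c z Hc0).
  (* The perturbed series is l1 - h l2 + l3: the exponential series, the series of S_n, and the
     quadratic remainder. *)
  destruct (Cis_series_exp_dominated (fun _ => 1) z 1 1) as [l1 [Hl1 _]];
    [lra|lra|intros n; rewrite Cmod_1, pow1; lra|].
  destruct (Cis_series_exp_dominated (shifted_harmonic c) z (/ d) 2) as [l2 [Hl2 _]];
    [apply Rlt_le; now apply Rinv_0_lt_compat|lra|intros n; now apply Cmod_shifted_harmonic|].
  destruct (Cis_series_exp_dominated
    (fun n => poch (c + h) n / poch (c + 2 * h) n - 1 + h * shifted_harmonic c n) z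
    (6 / d ^ 2 * Cmod h ^ 2) 2) as [l3 [Hl3 Hb]].
  - pose proof (Cmod_ge_0 h). apply Rmult_le_pos; [|now apply pow_le].
    apply Rdiv_le_0_compat; [lra|now apply pow_lt].
  - lra.
  - intros n. rewrite Rmult_comm. now apply poch_ratio_quadratic.
  - rewrite (CSeries_unique _ _ Hl2).
    replace (CSeries (fun n => z ^ n / INR (fact n))) with l1.
    2:{ symmetry. apply CSeries_unique. eapply is_series_ext; [|exact Hl1].
        intros n. apply Cmult_1_l. }
    assert (Hs := is_series_plus _ _ _ _ (is_series_plus _ _ _ _ Hl1
                     (is_series_scal (K := C_AbsRing) (V := C_NormedModule) (- h) _ _ Hl2)) Hl3).
    unfold hypergeom. rewrite (CSeries_unique _ (l1 + - h * l2 + l3)).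
    + replace (l1 + - h * l2 + l3 - l1 - h * - l2) with l3 by ring. nra.
    + eapply is_series_ext; [|exact Hs].
      intros n. unfold poch_prod. simpl fold_right. change plus with Cplus. change scal with Cmult.
      rewrite !Cmult_1_r. eq_at_C. ring.
Qed.

(** * The derivative series as an exponential times a 2F2 *)

Lemma Cmod_poch_lower_bound (c : C) (d : R) (n : nat) :
  (0 < d)%R -> (forall j, (d * INR (S j) <= Cmod (c + INR j))%R) ->
  (d ^ n * INR (fact n) <= Cmod (poch c n))%R.
Proof.
  intros Hd Hc. induction n as [|n IH].
  - simpl. rewrite Cmod_1. lra.
  - simpl poch. rewrite fact_simpl, mult_INR, Cmod_mult. simpl pow.
    replace (d * d ^ n * (INR (S n) * INR (fact n)))%R
      with (d ^ n * INR (fact n) * (d * INR (S n)))%R by ring.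
    apply Rmult_le_compat; try assumption; [| |apply Hc].
    + apply Rmult_le_pos; [apply pow_le; lra|apply pos_INR].
    + apply Rmult_le_pos; [lra|apply pos_INR].
Qed.

(** The factorial in [inv_diff] cancels against the one bounding (c)_n from below. The factor 1 is
    the M of [Cis_series_exp_dominated]. *)
Lemma Cmod_harmonic_diff (c : C) (d : R) (n : nat) :
  (0 < d)%R -> (forall j, (d * INR (S j) <= Cmod (c + INR j))%R) ->
  (Cmod (harmonic_diff c n) <= 1 * (/ d) ^ n)%R.
Proof.
  intros Hd Hc. rewrite Rmult_1_l.
  assert (Hi : (0 < / d)%R) by now apply Rinv_0_lt_compat.
  destruct n as [|n]; [simpl; rewrite Cmod_0; lra|].
  unfold harmonic_diff, inv_diff. rewrite Cplus_0_r.
  assert (Hp := Cmod_poch_lower_bound c d (S n) Hd Hc).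
  assert (HF : (0 < d ^ S n * INR (fact (S n)))%R).
  { apply Rmult_lt_0_compat; [now apply pow_lt|apply INR_fact_lt_0]. }
  assert (Hpi := Cmod_inv_le _ _ (conj HF Hp)).
  unfold Cdiv. rewrite !Cmod_mult, Cmod_pow, Cmod_m1, pow1, Cmod_R, Rabs_pos_eq, Rmult_1_l
    by apply pos_INR.
  eapply Rle_trans; [apply Rmult_le_compat_l; [apply pos_INR|exact Hpi]|].
  rewrite fact_simpl, mult_INR, pow_inv, !Rinv_mult.
  pose proof (INR_fact_lt_0 n).
  assert (0 < / d ^ S n)%R by (apply Rinv_0_lt_compat; now apply pow_lt).
  assert (/ INR (S n) <= 1)%R.
  { rewrite <- Rinv_1. apply Rinv_le_contravar; [lra|].
    rewrite S_INR. pose proof (pos_INR n). lra. }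
  replace (INR (fact n) * (/ d ^ S n * (/ INR (S n) * / INR (fact n))))%R
    with (/ d ^ S n * / INR (S n))%R
    by (field; repeat split; try lra;
        [apply not_0_INR; lia|apply Rgt_not_eq; now apply pow_lt]).
  nra.
Qed.

Lemma poch_1 (n : nat) : poch 1 n = INR (fact n).
Proof.
  induction n as [|n IH]; [easy|].
  simpl poch. rewrite IH, fact_simpl, mult_INR, RtoC_mult, INR_S_C. ring.
Qed.

Lemma poch_2 (n : nat) : poch 2 n = INR (fact (S n)).
Proof.
  rewrite <- poch_1, poch_S_l, Cmult_1_l. f_equal. rewrite <- RtoC_plus. f_equal.
Qed.

(** Uses (1)_n = n!, (2)_n = (n + 1)! and (c)_(n+1) = c (c + 1)_n; the sign (-1)^n is absorbed into
    (-z)^n. *)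
Lemma harmonic_diff_2F2_term (c z : C) (n : nat) : (forall j, c + INR j <> 0) ->
  harmonic_diff c (S n) * (z ^ S n / INR (fact (S n))) =
  z / c * (poch_prod (RtoC 1 :: RtoC 1 :: nil) n / poch_prod (c + 1 :: RtoC 2 :: nil) n *
           ((- z) ^ n / INR (fact n))).
Proof.
  intros Hc. unfold harmonic_diff, inv_diff, poch_prod. simpl fold_right.
  rewrite Cplus_0_r, poch_S_l, poch_1, poch_2.
  assert (Hc0 := Hc O). rewrite Cplus_0_r in Hc0.
  assert (Hp : poch (c + 1) n <> 0).
  { apply poch_neq_0. intros j. replace (c + 1 + INR j) with (c + INR (S j)); [apply Hc|].
    rewrite INR_S_C. ring. }
  replace (- z) with (- (1) * z) by ring. rewrite Cpow_mult_l.
  pose proof (INR_fact_neq_0_C n). pose proof (INR_fact_neq_0_C (S n)).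
  rewrite Cpow_S. field. auto.
Qed.

Lemma CSeries_harmonic_diff (c z : C) : (forall j, c + INR j <> 0) -> z <> 0 ->
  CSeries (fun n => harmonic_diff c n * (z ^ n / INR (fact n))) =
  z / c * hypergeom (RtoC 1 :: RtoC 1 :: nil) (c + 1 :: RtoC 2 :: nil) (- z).
Proof.
  intros Hc Hz. destruct (Cmod_shift_lower_bound c Hc) as [d [Hd Hdj]].
  assert (Hc0 := Hc O). rewrite Cplus_0_r in Hc0.
  destruct (Cis_series_exp_dominated (harmonic_diff c) z 1 (/ d)) as [l [Hl _]].
  - lra.
  - apply Rlt_le. now apply Rinv_0_lt_compat.
  - intros n. now apply Cmod_harmonic_diff.
  - rewrite (CSeries_unique _ _ Hl). unfold hypergeom.
    (* Convergence of the 2F2 series is read off from the other series divided by z / c, hence z <>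
       0. *)
    rewrite (CSeries_unique _ (c / z * l)); [field; auto|].
    (* The term of index 0 vanishes, so the shifted series has the same sum. *)
    assert (Hs : Cis_series (fun n => harmonic_diff c (S n) * (z ^ S n / INR (fact (S n)))) l).
    { apply (is_series_incr_1 (K := C_AbsRing) (V := C_NormedModule)
        (fun n => harmonic_diff c n * (z ^ n / INR (fact n)))).
      match goal with |- is_series _ ?s => replace s with l end; [exact Hl|].
      change plus with Cplus. simpl. ring. }
    apply (is_series_scal (K := C_AbsRing) (V := C_NormedModule) (c / z)) in Hs.
    eapply is_series_ext; [|exact Hs]. intros n. change scal with Cmult. cbv beta.
    rewrite harmonic_diff_2F2_term by assumption.
    eq_at_C.
    rewrite Cmult_assoc. replace (c / z * (z / c)) with (RtoC 1) by (field; auto).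
    apply Cmult_1_l.
Qed.

(** By [shifted_harmonic_convolution] the left side is the Cauchy product of the exponential series
    and the series of [harmonic_diff c], both absolutely convergent. *)
Lemma CSeries_shifted_harmonic (c : C) (x : R) : (forall j, c + INR j <> 0) -> x <> 0%R ->
  CSeries (fun n => shifted_harmonic c n * (x ^ n / INR (fact n))) =
  exp x * (x / c * hypergeom (RtoC 1 :: RtoC 1 :: nil) (c + 1 :: RtoC 2 :: nil) (- x)).
Proof.
  intros Hc Hx. destruct (Cmod_shift_lower_bound c Hc) as [d [Hd Hdj]].
  rewrite <- CSeries_harmonic_diff; [|assumption|intros H; apply Hx; now injection H].
  rewrite Cmult_comm, <- (is_series_unique _ _ (is_series_exp x)).
  rewrite <- CSeries_mult_RtoC.
  - apply CSeries_ext. intros N.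
    transitivity (RtoC (x ^ N) * (shifted_harmonic c N * (/ INR (fact N))%R)).
    { rewrite RtoC_pow, RtoC_inv by apply INR_fact_neq_0. unfold Cdiv. ring. }
    rewrite <- (shifted_harmonic_convolution c N Hc), <- sum_n_Cmult_l.
    apply sum_n_ext_loc. intros n Hn.
    eq_at_C.
    unfold Rdiv, Cdiv. rewrite !RtoC_mult, !RtoC_pow, !RtoC_inv by apply INR_fact_neq_0.
    replace N with (n + (N - n))%nat at 1 by lia. rewrite Cpow_add_r. ring.
  - eapply (ex_series_le (K := R_AbsRing) (V := R_CompleteNormedModule));
      [|exists (exp (/ d * Cmod x)); apply (is_series_exp (/ d * Cmod x))].
    intros n. change (Rabs (Cmod (harmonic_diff c n * (x ^ n / INR (fact n)))) <=
                      (/ d * Cmod x) ^ n / INR (fact n))%R.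
    rewrite Rabs_pos_eq, Cmod_mult, Cmod_exp_term, Rpow_mult_distr by apply Cmod_ge_0.
    replace ((/ d) ^ n * Cmod x ^ n / INR (fact n))%R
      with ((/ d) ^ n * (Cmod x ^ n / INR (fact n)))%R by (unfold Rdiv; ring).
    apply Rmult_le_compat_r.
    + rewrite <- Cmod_exp_term. apply Cmod_ge_0.
    + rewrite <- (Rmult_1_l ((/ d) ^ n)). now apply Cmod_harmonic_diff.
  - eapply ex_series_ext; [|exists (exp (Rabs x)); apply is_series_exp].
    intros n. cbv beta. unfold Rdiv.
    rewrite Rabs_mult, RPow_abs, Rabs_inv, (Rabs_pos_eq (INR _)); [easy|apply pos_INR].
Qed.

Lemma CSeries_exp (x : R) : CSeries (fun n => x ^ n / INR (fact n)) = RtoC (exp x).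
Proof.
  assert (H : forall n, (x : C) ^ n / INR (fact n) = RtoC (x ^ n / INR (fact n))%R).
  { intros n. now rewrite RtoC_div, RtoC_pow by apply INR_fact_neq_0. }
  rewrite (CSeries_ext _ _ H). apply injective_projections.
  - exact (is_series_unique _ _ (is_series_exp x)).
  - transitivity (0 * Series (fun _ => 0))%R; [|apply Rmult_0_l].
    rewrite <- Series_scal_l. apply Series_ext. intros n. symmetry. apply Rmult_0_l.
Qed.

(** * The product rule for the Whittaker function *)

Theorem theorem8 (mu0 : C) (x : R)
    (hmu0 : forall n : nat, (1 <= n)%nat -> 2 * mu0 <> - INR n)
    (hx : x <> 0%R) :
  is_derive (K := C_AbsRing) (V := C_NormedModule)
    (fun mu : C => WhittakerM (- mu0 - 1 / 2) mu x) mu0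
    (Cpower x (mu0 + 1 / 2) * Cexp (x / 2) *
     (Clog x - x / (1 + 2 * mu0) *
        hypergeom (RtoC 1 :: RtoC 1 :: nil)
                  (2 * (mu0 + 1) :: RtoC 2 :: nil) (- x))).
Proof.
  set (c := 1 + 2 * mu0).
  assert (Hc : forall j, c + INR j <> 0).
  { intros j H. apply (hmu0 (S j)); [lia|]. rewrite INR_S_C.
    replace (2 * mu0) with (c + INR j - (INR j + 1)) by (unfold c; ring).
    rewrite H. ring. }
  set (H := fun mu => hypergeom (1 / 2 + mu - (- mu0 - 1 / 2) :: nil) (1 + 2 * mu :: nil) x).
  set (F := hypergeom (RtoC 1 :: RtoC 1 :: nil) (2 * (mu0 + 1) :: RtoC 2 :: nil) (- x)).
  (* At mu0 the chosen kappa makes both 1F1 parameters equal to c, leaving the exponential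
     series. *)
  assert (HH0 : H mu0 = RtoC (exp x)).
  { rewrite <- CSeries_exp, <- (hypergeom_1F1_diag c) by assumption. unfold H, c.
    do 2 f_equal. field. }
  assert (HdH : is_derive (K := C_AbsRing) (V := AbsRing_NormedModule C_AbsRing) H mu0
                  (- (exp x * (x / c * F)))).
  { destruct (hypergeom_1F1_diag_quadratic c x Hc) as [K [d [Hd Hq]]].
    apply is_derive_quadratic with (K := K) (d := d); [assumption|].
    intros h Hh. specialize (Hq h Hh).
    rewrite (CSeries_shifted_harmonic c x Hc hx) in Hq.
    unfold H, F.
    (* With kappa fixed, a shift of mu by h moves the upper parameter by h and the lower one by 2
       h. *)
    replace (1 / 2 + (mu0 + h) - (- mu0 - 1 / 2)) with (c + h) by (unfold c; field).
    replace (1 / 2 + mu0 - (- mu0 - 1 / 2)) with c by (unfold c; field).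
    replace (1 + 2 * (mu0 + h)) with (c + 2 * h) by (unfold c; ring).
    replace (2 * (mu0 + 1)) with (c + 1) by (unfold c; ring).
    exact Hq. }
  apply is_derive_C_NormedModule.
  assert (HP := is_derive_Cpower x (1 / 2) mu0).
  apply (is_derive_scal_l (K := C_AbsRing) (V := AbsRing_NormedModule C_AbsRing)
           _ _ _ (Cexp (- x / 2))) in HP.
  assert (HD := is_derive_mult (K := C_AbsRing) _ _ _ _ _ HP HdH Cmult_comm).
  match type of HD with is_derive _ _ ?l =>
    match goal with |- is_derive _ _ ?l' => replace l' with l; [exact HD|] end end.
  change mult with Cmult. change plus with Cplus. change scal with Cmult. cbv beta.
  rewrite HH0.
  (* Both terms of the product rule carry e^(-x/2) e^x, which is the e^(x/2) of the claim. *)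
  replace (Cexp (x / 2)) with (Cexp (- x / 2) * exp x).
  2:{ rewrite <- Cexp_RtoC, <- Cexp_plus. f_equal. field. }
  eq_at_C. ring.
Qed.
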